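(* Let $(X_n)$ be a countable (finite or countably infinite) family of metric spaces and $X=\prod_n X_n$ with the product topology. For every $n$, let $\phi_n : B^+_{b,n}\to\mathbb{R}_+$ be a mapping such that for all $m,\varepsilon\in\mathbb{R}_+\setminus\{0\}$ there exists a compact set $K_n\subseteq X_n$ with $\phi_n(m 1_{K_n^c})\le\varepsilon$. Let $\phi : B_b\to\mathbb{R}$ be an increasing convex functional satisfying $\phi(f)\le\sum_n\phi_n(g_n)$ for all $f\in B_b$ and $g_n\in B^+_{b,n}$ such that $f\le\oplus g$. Then $$\phi(f)=\max_{\mu\in ca^+}\big(\langle f,\mu\rangle-\phi^*_{C_b}(\mu)\big)\quad\text{for all } f\in C_b$$ (in particular, the maximum is attained).
   Context: $B_b$ is the space of all bounded Borel measurable functions $f:X\to\mathbb{R}$ and $C_b\subseteq B_b$ the subspace of bounded continuous functions. $B^+_{b,n}$ is the set of all bounded Borel measurable functions $g:X_n\to\mathbb{R}_+=[0,\infty)$. $ca^+$ is the set of all finite (nonnegative) Borel measures on $X$. $\langle f,\mu\rangle:=\int f\,d\mu$. For a family $g=(g_n)$ with $g_n\in B^+_{b,n}$, $\oplus g:=\sum_n g_n\circ\pi_n : X\to\mathbb{R}_+\cup\{+\infty\}$, where $\pi_n:X\to X_n$ is the projection on the $n$-th coordinate. Inequalities between functions are pointwise; ''increasing'' means $\phi(f)\ge\phi(g)$ whenever $f\ge g$. The sum $\sum_n\phi_n(g_n)$ takes values in $[0,+\infty]$. The convex conjugate $\phi^*_{C_b}:ca^+\to\mathbb{R}\cup\{+\infty\}$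 is $\phi^*_{C_b}(\mu):=\sup_{f\in C_b}(\langle f,\mu\rangle-\phi(f))$. *)

(* Defs.v *)
From HB Require Import structures.
From mathcomp Require Import all_boot all_order all_algebra.
From mathcomp Require Import all_classical all_reals all_analysis.

Set Implicit Arguments.
Unset Strict Implicit.
Unset Printing Implicit Defensive.

Import Order.TTheory GRing.Theory Num.Theory.
Import numFieldNormedType.Exports.
Local Open Scope classical_set_scope.
Local Open Scope ring_scope.

(* Nonempty metric spaces: the library's measurable types, hence its measures
   and integrals, live on pointed types. *)
#[short(type="pmetricType")]
HB.structure Definition PointedMetric (R : numDomainType) :=
  {T of Pointed T & Metric R T}.

HB.instance Definition _ (I : Type) (T : I -> ptopologicalType) :=
  isPointed.Build (prod_topology T) (fun=> point).

Definition borel (T : ptopologicalType) := g_sigma_algebraType (@open T).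

(* A functional on one of these classes is encoded as a total map on
   [T -> R^o]; only its values on the class are ever constrained or used. *)
Section function_classes.
Context {R : realType}.
Implicit Type T : ptopologicalType.

Definition Bb T : set (T -> R^o) :=
  [set f | measurable_fun [set: borel T] (f : borel T -> R) /\ bounded_fun f].

Definition Cb T : set (T -> R^o) := [set f | continuous f /\ bounded_fun f].

Definition Bb_nneg T : set (T -> R^o) :=
  [set g | Bb g /\ forall x, 0 <= g x].

End function_classes.

Section duality.
Context {R : realType} {T : ptopologicalType}.

Definition ca_pos : Type := {finite_measure set (borel T) -> \bar R}.

Definition pairing (f : T -> R^o) (mu : ca_pos) : \bar R :=
  (\int[mu]_(x in [set: borel T]) (f x)%:E)%E.

Definition conjugate_Cb (phi : (T -> R^o) -> R) (mu : ca_pos) : \bar R :=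
  ereal_sup [set (pairing f mu - (phi f)%:E)%E | f in @Cb R T].

End duality.
Arguments ca_pos R T : clear implicits.

Definition is_max {R : realType} (A : set (\bar R)) (a : \bar R) :=
  A a /\ ubound A a.

Definition oplus {R : realType} {I : choiceType} {X : I -> Type}
    (g : forall i, X i -> R^o) (x : prod_topology X) : \bar R :=
  (\esum_(i in [set: I]) (g i (x i))%:E)%E.

Definition increasing_on {R : realType} {T : Type} (D : set (T -> R^o))
    (phi : (T -> R^o) -> R) :=
  forall f g, D f -> D g -> (forall x, f x <= g x) -> phi f <= phi g.

(* Main.v *)
Require Import Defs.
From HB Require Import structures.
From mathcomp Require Import all_boot all_order all_algebra.
From mathcomp Require Import all_classical all_reals all_analysis.
From mathcomp Require Import measurable_realfun.
From mathcomp Require Import lra ring.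
Import Order.TTheory GRing.Theory Num.Theory.
Import numFieldNormedType.Exports.
Local Open Scope classical_set_scope.
Local Open Scope ring_scope.

(** Fix [f] in [Cb].  A subgradient of [phi] at [f] is a linear form [l] on
    [Cb] with [l g <= phi (f + g) - phi f]; it exists by the Hahn-Banach
    theorem ([hahn_banach_convex]), because the right-hand side is convex in
    [g] and vanishes at 0, and it is positive because [phi] is increasing.

    If [l] is integration against a finite measure [mu], the result follows
    from Fenchel's argument: applying the subgradient inequality to [g - f]
    gives [l g - phi g <= l f - phi f] for every [g] in [Cb], so the supremum
    defining the conjugate at [mu] is reached at [f] and
    [<f, mu> - phi^* mu = phi f]; the upper bound by [phi f] for all measures
    is the definition of the conjugate.

    To represent [l] by a measure, Daniell's condition is enough: [l (u n)]
    must tend to 0 whenever [u n] in [Cb] decreases pointwise to 0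
    ([riesz_daniell]).  Here the marginal constraints enter.  Choosing compact
    sets [K_i] with costs summing to at most [e], the box [K = \prod_i K_i] is
    compact by Tychonoff and [phi (m 1_{K^c}) <= e] ([product_tight]).  On [K]
    the convergence of [u n] is uniform by Dini's theorem, and convexity turns
    the smallness of [phi] on multiples of [1_{K^c}] into
    [phi (f + u n) -> phi f] ([tight_continuity]), hence [l (u n) -> 0].

    The representation theorem is proved on a space all of whose open sets are
    cozero sets.  A countable product of metric spaces is pseudometrizable, so
    it has this property ([open_cozero]).  The mass of an open set [U] is the
    supremum of [l] over the functions between 0 and [1_U], and Caratheodory's
    construction extends it to the Borel sets. *)

(** * A dominated extension theorem for convex functions *)

Section hahn_banach.
Set Implicit Arguments.
Unset Strict Implicit.
Context {R : realType} {V : lmodType R} (D : set V) (p : V -> R).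
Hypothesis D0 : D 0.
Hypothesis Dlin : forall a x y, D x -> D y -> D (a *: x + y).
Hypothesis p_convex : forall (s t : R) x y, 0 < s -> 0 < t -> D x -> D y ->
  s + t = 1 -> p (s *: x + t *: y) <= s * p x + t * p y.
Hypothesis p0 : 0 <= p 0.

(** Partially defined linear forms are encoded by their graphs, so that Zorn's
    lemma applies to inclusion of sets.  Closure under [a u + v] does not put
    [(0, 0)] in the graph: the empty graph is allowed, as the union of the empty
    chain has to be. *)
Definition dominated_graph (G : set (V * R)) :=
  (forall a u v, G u -> G v -> G (a *: u.1 + v.1, a * u.2 + v.2)) /\
  (forall u, G u -> D u.1 /\ u.2 <= p u.1).

(** Two distinct values over the same point would put a whole line
    [(0, k (r - s))] in the graph, and this line cannot stay below [p 0]. *)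
Lemma dominated_graph_functional G x r s : dominated_graph G ->
  G (x, r) -> G (x, s) -> r = s.
Proof.
move=> [Glin Gp] Gr Gs.
have G0 (k : R) : k * (r - s) <= p 0.
  have G1 := Glin (- 1) _ _ Gs Gr.
  have G2 := Glin (- 1) _ _ Gr Gr.
  have /Gp[_] := Glin k _ _ G1 G2.
  rewrite /= !scaleN1r !addNr scaler0 addr0; apply: le_trans.
  by rewrite le_eqVlt; apply/orP; left; apply/eqP; ring.
apply/eqP; rewrite -subr_eq0; apply/negPn/negP => rs.
have := G0 ((p 0 + 1) / (r - s)); rewrite divfK//.
by rewrite gerDl ler10.
Qed.

(** The value [c] at [v] must lie above all lower slopes
    [(w.2 - p (w.1 - s v)) / s] and below all upper slopes
    [(p (w.1 + t v) - w.2) / t].  Each lower slope is at most each upper one by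
    convexity of [p], since the barycentre of [w.1 - s v] and [w'.1 + t v] with
    weights [t / (s + t)] and [s / (s + t)] no longer involves [v]. *)
Lemma dominated_graph_extend G v : dominated_graph G -> G (0, 0) -> D v ->
  exists c, dominated_graph
    [set u | exists w t, G w /\ u = (w.1 + t *: v, w.2 + t * c)].
Proof.
move=> [Glin Gp] G00 Dv.
have DG w t : G w -> D (w.1 + t *: v).
  by move=> /Gp[Dw _]; rewrite addrC; exact: Dlin.
have key w w' (s t : R) : G w -> G w' -> 0 < s -> 0 < t ->
    (w.2 - p (w.1 - s *: v)) / s <= (p (w'.1 + t *: v) - w'.2) / t.
  move=> Gw Gw' s0 t0.
  have st0 : 0 < s + t by rewrite addr_gt0.
  have stn0 : s + t != 0 by rewrite gt_eqF.
  have Gm : G ((t / (s + t)) *: w.1 + (s / (s + t)) *: w'.1,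
               t / (s + t) * w.2 + s / (s + t) * w'.2).
    have := Glin (t / (s + t)) _ _ Gw (Glin (s / (s + t)) _ _ Gw' G00).
    by rewrite /= !addr0.
  have [_ /=] := Gp _ Gm.
  have Dw : D (w.1 - s *: v) by rewrite -scaleNr; exact: DG.
  have Dw' := DG _ t Gw'.
  have ts1 : t / (s + t) + s / (s + t) = 1 by field.
  have := p_convex (divr_gt0 t0 st0) (divr_gt0 s0 st0) Dw Dw' ts1.
  have -> : (t / (s + t)) *: (w.1 - s *: v) + (s / (s + t)) *: (w'.1 + t *: v)
     = (t / (s + t)) *: w.1 + (s / (s + t)) *: w'.1.
    rewrite !scalerDr scalerN !scalerA addrACA.
    have -> : t / (s + t) * s = s / (s + t) * t by ring.
    by rewrite addNr addr0.
  set P := p (w.1 - _); set P' := p (w'.1 + _) => h1 h2.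
  rewrite ler_pdivrMr// mulrAC ler_pdivlMr//.
  have := le_trans h2 h1.
  rewrite ![_ / _ * _]mulrAC -!mulrDl ler_pM2r ?invr_gt0//; lra.
pose A := [set (w.1.2 - p (w.1.1 - w.2 *: v)) / w.2 | w in
   [set w : (V * R) * R | G w.1 /\ 0 < w.2]].
have A0 : A !=set0.
  by exists ((0 - p (0 - 1 *: v)) / 1); exists ((0, 0), 1) => //; split.
have ubA w t : G w -> 0 < t -> ubound A ((p (w.1 + t *: v) - w.2) / t).
  by move=> Gw t0 _ [[w' s]/= [Gw' s0] <-]; exact: key.
have hA : has_sup A.
  by split => //; exists ((p (0 + 1 *: v) - 0) / 1); exact: (ubA (0, 0)).
exists (sup A); split.
  move=> a _ _ [w [t [Gw ->]]] [w' [t' [Gw' ->]]] /=.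
  exists (a *: w.1 + w'.1, a * w.2 + w'.2), (a * t + t'); split.
    exact: Glin.
  congr pair => /=; last by ring.
  by rewrite scalerDr addrACA scalerA -scalerDl.
move=> _ [w [t [Gw ->]]] /=; split; first exact: DG.
have [t0|t0|->] := ltgtP t 0.
- have s0 : 0 < - t by rewrite oppr_gt0.
  have : (w.2 - p (w.1 - (- t) *: v)) / - t <= sup A.
    by apply: ub_le_sup; [case: hA|exists (w, - t)].
  rewrite ler_pdivrMr// scaleNr opprK; lra.
- have : sup A <= (p (w.1 + t *: v) - w.2) / t.
    by apply: ge_sup => //; exact: ubA.
  rewrite ler_pdivlMr//; lra.
- by rewrite scale0r mul0r !addr0; have [] := Gp _ Gw.
Qed.

Lemma hahn_banach_convex : exists l : V -> R,
  (forall a x y, D x -> D y -> l (a *: x + y) = a * l x + l y) /\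
  (forall x, D x -> l x <= p x).
Proof.
have [F FP totF|G [dG maxG]] := @Zorn_bigcup _ dominated_graph.
  split; last by move=> u [G FG Gu]; have [_] := FP _ FG; exact.
  move=> a u v [G FG Gu] [H FH Hv].
  have [GH|HG] := totF _ _ FG FH.
  - by exists H => //; have [+ _] := FP _ FH; apply => //; exact: GH.
  - by exists G => //; have [+ _] := FP _ FG; apply => //; exact: HG.
have G00 : G (0, 0).
  have [G0|/set0P[[x r] Gxr]] := eqVneq G set0; last first.
    have := dG.1 (- 1) _ _ Gxr Gxr.
    by rewrite /= scaleN1r mulN1r !addNr.
  exfalso; apply: (maxG [set (0, 0)]).
    by rewrite G0; split => // /(_ (0, 0)); exact.
  split => [a u v -> ->|u ->//] /=.
  by rewrite scaler0 mulr0 !addr0.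
have totG x : D x -> exists r, G (x, r).
  move=> Dx; have [c dH] := dominated_graph_extend dG G00 Dx.
  apply: contrapT => nG; apply: maxG dH; split.
    by move=> [y r] Gyr; exists (y, r), 0; rewrite scale0r mul0r !addr0.
  move=> /(_ (x, c)) hG; apply: nG; exists c; apply: hG.
  by exists (0, 0), 1; rewrite scale1r mul1r !add0r.
pose l x := xget 0 [set r | G (x, r)].
have Gl x : D x -> G (x, l x).
  by move=> /totG[r Gr]; apply: (@xgetPex _ 0 [set r | G (x, r)]); exists r.
exists l; split => [a x y Dx Dy|x Dx]; last by have [] := dG.2 _ (Gl _ Dx).
apply: (dominated_graph_functional dG (Gl _ (Dlin _ Dx Dy))).
exact: (dG.1 a _ _ (Gl _ Dx) (Gl _ Dy)).
Qed.

End hahn_banach.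

(** * Bounded continuous functions *)

Section continuous_bounded.
Set Implicit Arguments.
Unset Strict Implicit.
Context {R : realType} {T : ptopologicalType}.
Implicit Types f g : T -> R^o.

Lemma CbP f : Cb f <-> continuous f /\ exists M, forall x, `|f x| <= M.
Proof.
have ? : ProperFilter (globally [set: T]).
  exact: (globally_properfilter (a := point)).
split=> -[cf bf]; split => //.
  by have [M fM] := (ex_bound _).1 bf; exists M => x; exact: fM.
by apply/ex_bound; have [M fM] := bf; exists M => x _; exact: fM.
Qed.

Lemma Cb_cst (c : R) : Cb (cst c : T -> R^o).
Proof. by apply/CbP; split; [exact: cst_continuous|exists `|c|]. Qed.

Lemma Cb_lin (a : R) f g : Cb f -> Cb g -> Cb (a *: f + g).
Proof.
move=> /CbP[cf [M fM]] /CbP[cg [N gN]]; apply/CbP; split.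
  move=> x; apply: continuousD; last exact: cg.
  by apply: continuousM; [exact: cst_continuous|exact: cf].
exists (`|a| * M + N) => x.
rewrite (le_trans (ler_normD _ _))// lerD ?gN//.
by rewrite normrM ler_wpM2l.
Qed.

Lemma CbD f g : Cb f -> Cb g -> Cb (f + g).
Proof. by move=> *; rewrite -(scale1r f); exact: Cb_lin. Qed.

Lemma CbZ (a : R) f : Cb f -> Cb (a *: f).
Proof. by move=> Cf; rewrite -(addr0 (_ *: _)); apply/Cb_lin/Cb_cst. Qed.

Lemma CbN f : Cb f -> Cb (- f).
Proof. by move=> *; rewrite -scaleN1r; exact: CbZ. Qed.

Lemma CbB f g : Cb f -> Cb g -> Cb (f - g).
Proof. by move=> *; apply/CbD/CbN. Qed.

Lemma Cb_sum (I : Type) (r : seq I) (F : I -> T -> R^o) :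
  (forall i, Cb (F i)) -> Cb (\sum_(i <- r) F i).
Proof. by move=> CF; elim/big_ind : _ => //; [exact: Cb_cst|exact: CbD]. Qed.

Lemma Cb_min f g : Cb f -> Cb g -> Cb (f \min g : T -> R^o).
Proof.
move=> /CbP[cf [M fM]] /CbP[cg [N gN]]; apply/CbP; split.
  by move=> x; apply: continuous_min; [exact: cf|exact: cg].
exists (Num.max M N) => x /=; rewrite minEle.
by case: ifP => _; rewrite le_max ?fM ?gN ?orbT.
Qed.

Lemma Cb_max f g : Cb f -> Cb g -> Cb (f \max g : T -> R^o).
Proof.
move=> /CbP[cf [M fM]] /CbP[cg [N gN]]; apply/CbP; split.
  by move=> x; apply: continuous_max; [exact: cf|exact: cg].
exists (Num.max M N) => x /=; rewrite maxEle.
by case: ifP => _; rewrite le_max ?fM ?gN ?orbT.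
Qed.

Lemma open_borel (U : set T) : open U -> measurable (U : set (borel T)).
Proof. by move=> oU; exact: sub_sigma_algebra. Qed.

Lemma closed_borel (U : set T) : closed U -> measurable (U : set (borel T)).
Proof.
move=> cU; rewrite -(setCK U); apply: measurableC.
by apply: open_borel; exact: closed_openC.
Qed.

Lemma Cb_Bb f : Cb f -> Bb f.
Proof.
move=> [cf bf]; split => //.
move=> mD; apply: (measurability _ (RGenOpens.measurableE R)) => //.
move=> _ [_ [a [b ->] <-]]; rewrite setTI; apply: open_borel.
by have /continuousP := cf; apply; exact: interval_open.
Qed.

End continuous_bounded.

(** * Positive linear forms on bounded continuous functions *)

Section linear_on_Cb.
Set Implicit Arguments.
Unset Strict Implicit.
Context {R : realType} {T : ptopologicalType} (L : (T -> R^o) -> R).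
Implicit Types f g : T -> R^o.

Hypothesis L_lin : forall a f g, Cb f -> Cb g -> L (a *: f + g) = a * L f + L g.

Lemma linD f g : Cb f -> Cb g -> L (f + g) = L f + L g.
Proof. by move=> Cf Cg; rewrite -{1}(scale1r f) L_lin// mul1r. Qed.

Lemma lin0 : L 0 = 0.
Proof.
have := linD (Cb_cst 0) (Cb_cst 0).
by rewrite addr0 => /eqP; rewrite -subr_eq subrr => /eqP.
Qed.

Lemma linZ a f : Cb f -> L (a *: f) = a * L f.
Proof.
by move=> Cf; rewrite -(addr0 (a *: f)) L_lin ?lin0 ?addr0//; exact: Cb_cst.
Qed.

Lemma linB f g : Cb f -> Cb g -> L (f - g) = L f - L g.
Proof.
move=> Cf Cg; rewrite linD; [|by []|exact: CbN].
by rewrite -(scaleN1r g) linZ// mulN1r.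
Qed.

Lemma lin_sum (I : Type) (r : seq I) (F : I -> T -> R^o) :
  (forall i, Cb (F i)) -> L (\sum_(i <- r) F i) = \sum_(i <- r) L (F i).
Proof.
move=> CF; elim: r => [|i r ih]; first by rewrite !big_nil lin0.
by rewrite !big_cons linD ?ih//; exact: Cb_sum.
Qed.

Hypothesis L_ge0 : forall f, Cb f -> (forall x, 0 <= f x) -> 0 <= L f.

Lemma lin_le f g : Cb f -> Cb g -> (forall x, f x <= g x) -> L f <= L g.
Proof.
move=> Cf Cg fg; rewrite -subr_ge0 -linB//; apply: L_ge0; first exact: CbB.
by move=> x; rewrite subr_ge0.
Qed.

End linear_on_Cb.

(** * The measure of a Daniell-continuous positive linear form *)

Section positive_functional.
Set Implicit Arguments.
Unset Strict Implicit.
Context {R : realType} {T : ptopologicalType} (L : (T -> R^o) -> R).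
Implicit Types (f g : T -> R^o) (U V : set T).

Hypothesis L_lin : forall a f g, Cb f -> Cb g -> L (a *: f + g) = a * L f + L g.
Hypothesis L_ge0 : forall f, Cb f -> (forall x, 0 <= f x) -> 0 <= L f.

Let LD f g := @linD _ _ _ L_lin f g.
Let L0 := lin0 L_lin.
Let LZ a f := @linZ _ _ _ L_lin a f.
Let L_sum I r F := @lin_sum _ _ _ L_lin I r F.
Let L_le f g := @lin_le _ _ _ L_lin L_ge0 f g.

Let LT_ge0 : 0 <= L (cst 1).
Proof. by apply: L_ge0; first exact: Cb_cst. Qed.

Definition below U g := Cb g /\ forall x, 0 <= g x <= \1_U x.

Lemma belowP U g : Cb g -> (forall x, 0 <= g x <= 1) ->
  (forall x, 0 < g x -> U x) -> below U g.
Proof.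
move=> Cg g01 gU; split => // x; have /andP[g0 g1] := g01 x.
rewrite g0 indicE; case: (boolP (x \in U)) => [//|xU].
by rewrite leNgt; apply/negP => /gU/mem_set; apply/negP.
Qed.

Lemma below_le1 U g x : below U g -> 0 <= g x <= 1.
Proof.
move=> [_ /(_ x) /andP[-> /= /le_trans]]; apply.
by rewrite indicE; case: (_ \in _).
Qed.

Lemma below_gt0 U g x : below U g -> 0 < g x -> U x.
Proof.
move=> [_ /(_ x) /andP[_]]; rewrite indicE.
by case: (boolP (x \in U)) => [/set_mem//|_ g0]; rewrite ltNge g0.
Qed.

(** For the measure representing [L] this is the measure of [U] when [U] is
    open and cozero: [1_U] is then the limit of an increasing sequence of
    functions [g] with [below U g]. *)
Definition inner_mass U : \bar R := ereal_sup [set (L g)%:E | g in below U].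

Lemma inner_mass_ge U g : below U g -> ((L g)%:E <= inner_mass U)%E.
Proof. by move=> bg; apply: ereal_sup_ubound; exists g. Qed.

Lemma inner_mass_ge0 U : (0 <= inner_mass U)%E.
Proof.
rewrite -[0%E]/(0%:E) -L0; apply: inner_mass_ge; apply: belowP.
- exact: Cb_cst.
- by move=> x; rewrite lexx ler01.
- by move=> x; rewrite ltxx.
Qed.

Lemma inner_mass_le U V : U `<=` V -> (inner_mass U <= inner_mass V)%E.
Proof.
move=> UV; apply: ge_ereal_sup => _ [g bg <-]; apply: inner_mass_ge.
apply: belowP; first by case: bg.
- by move=> x; exact: below_le1 bg.
- by move=> x /(below_gt0 bg)/UV.
Qed.

Lemma inner_mass_setT : inner_mass setT = (L (cst 1))%:E.
Proof.
apply/eqP; rewrite eq_le; apply/andP; split.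
  apply: ge_ereal_sup => _ [g bg <-]; rewrite lee_fin.
  apply: L_le; [by case: bg|exact: Cb_cst|].
  by move=> x; have /andP[] := below_le1 x bg.
apply: inner_mass_ge; apply: belowP => //; first exact: Cb_cst.
by move=> x; rewrite ler01 lexx.
Qed.

Lemma inner_mass_fin U : inner_mass U \is a fin_num.
Proof.
rewrite ge0_fin_numE ?inner_mass_ge0//;
  apply: (@le_lt_trans _ _ (inner_mass setT)).
  exact: inner_mass_le.
by rewrite inner_mass_setT ltry.
Qed.

Lemma inner_mass_set0 : inner_mass set0 = 0%E.
Proof.
apply/eqP; rewrite eq_le inner_mass_ge0 andbT.
apply: ge_ereal_sup => _ [g bg <-].
rewrite lee_fin -L0; apply: L_le; [by case: bg|exact: Cb_cst|].
move=> x; rewrite leNgt; apply/negP; exact: below_gt0 bg.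
Qed.

Definition outer_mass A : \bar R :=
  ereal_inf [set inner_mass U | U in [set U | open U /\ A `<=` U]].

Lemma outer_mass_le_inner A U : open U -> A `<=` U ->
  (outer_mass A <= inner_mass U)%E.
Proof. by move=> oU AU; apply: ereal_inf_lbound; exists U. Qed.

Lemma outer_mass_le A B : A `<=` B -> (outer_mass A <= outer_mass B)%E.
Proof.
move=> AB; apply: le_ereal_inf_tmp => _ [U [oU BU] <-].
by apply: outer_mass_le_inner => //; exact: subset_trans BU.
Qed.

Lemma outer_mass_open U : open U -> outer_mass U = inner_mass U.
Proof.
move=> oU; apply/eqP; rewrite eq_le outer_mass_le_inner//=.
by apply: le_ereal_inf_tmp => _ [V [oV UV] <-]; exact: inner_mass_le.
Qed.

Lemma outer_mass_ge0 A : (0 <= outer_mass A)%E.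
Proof. by apply: le_ereal_inf_tmp => _ [U _ <-]; exact: inner_mass_ge0. Qed.

Lemma outer_mass_set0 : outer_mass set0 = 0%E.
Proof. by rewrite outer_mass_open ?inner_mass_set0//; exact: open0. Qed.

Lemma outer_mass_fin A : outer_mass A \is a fin_num.
Proof.
rewrite ge0_fin_numE ?outer_mass_ge0//;
  apply: (@le_lt_trans _ _ (inner_mass setT)).
  by apply: outer_mass_le_inner => //; exact: openT.
by rewrite inner_mass_setT ltry.
Qed.

Lemma open_lt_Cb g (e : R) : Cb g -> open [set x | g x < e].
Proof.
move=> [cg _]; have /continuousP/(_ [set y : R^o | y < e]) := cg.
by apply; exact: open_lt.
Qed.

Lemma open_gt_Cb g (e : R) : Cb g -> open [set x | e < g x].
Proof.
move=> [cg _]; have /continuousP/(_ [set y : R^o | e < y]) := cg.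
by apply; exact: open_gt.
Qed.

(** A function [g] below [V `&` U] is replaced by its truncation [(g - e)^+],
    which costs at most [e L 1].  The set [W] of points of [V] where [g < e] is
    then an open neighbourhood of [V `\` U] on which the truncation vanishes, so
    any function below [W] can be added to it while staying below [V]. *)
Lemma inner_mass_split U V : open U -> open V ->
  (inner_mass (V `&` U) + outer_mass (V `&` ~` U) <= inner_mass V)%E.
Proof.
move=> oU oV.
rewrite -(fineK (inner_mass_fin V)) -(fineK (outer_mass_fin (V `&` ~` U))).
rewrite -leeBrDr//; apply: ge_ereal_sup => _ [g bg <-].
rewrite -EFinB lee_fin lerBrDr.
apply/ler_addgt0Pr => e' e'0.
(* this truncation level makes the loss [e * L 1] at most [e'] *)
pose e := e' / (1 + L (cst 1)).
have L1 : 0 < 1 + L (cst 1) by rewrite ltr_pwDl.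
have e0 : 0 < e by rewrite divr_gt0.
have eL : e * L (cst 1) <= e'.
  by rewrite /e mulrAC ler_pdivrMr// ler_wpM2l ?(ltW e'0)// lerDr.
have Cg : Cb g by case: bg.
pose ge : T -> R^o := (g - cst e) \max cst 0.
have Cge : Cb ge by apply: Cb_max (Cb_cst _); apply: CbB (Cb_cst _).
have Lg : L g <= L ge + e'.
  apply: (@le_trans _ _ (L ge + e * L (cst 1))); last by rewrite lerD2l.
  rewrite -LZ; last exact: Cb_cst.
  rewrite -LD//; last exact/CbZ/Cb_cst.
  apply: L_le => //; first by apply: CbD => //; exact/CbZ/Cb_cst.
  move=> x; rewrite -[X in _ <= X]/(Num.max (g x - e) 0 + e * 1) mulr1 -lerBlDr.
  by rewrite le_max lexx.
pose W := V `&` [set x | g x < e].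
have oW : open W by apply: openI => //; exact: open_lt_Cb.
have VUW : V `&` ~` U `<=` W.
  move=> x [Vx nUx]; split => //=; apply: le_lt_trans e0.
  by rewrite leNgt; apply/negP => /(below_gt0 bg)[].
have : (outer_mass (V `&` ~` U) <= (fine (inner_mass V) - L ge)%:E)%E.
  apply: le_trans (outer_mass_le_inner oW VUW) _.
  apply: ge_ereal_sup => _ [h bh <-]; rewrite lee_fin lerBrDr.
  have Ch : Cb h by case: bh.
  rewrite -LD// -lee_fin fineK ?inner_mass_fin//; apply: inner_mass_ge.
  have hge x : (h + ge) x = h x \/ (h x = 0 /\ ge x <= g x /\ 0 < g x).
    have [gx|gx] := ltP (g x) e.
      left; rewrite -[LHS]/(h x + Num.max (g x - e) 0).
      by rewrite max_r ?addr0// subr_le0 ltW.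
    right; split.
      have /andP[h0 _] := below_le1 x bh.
      apply/eqP; rewrite eq_le h0 andbT leNgt; apply/negP => /(below_gt0 bh).
      by move=> [_ /=]; rewrite ltNge gx.
    have g0 := lt_le_trans e0 gx; split => //.
    by rewrite ge_max (ltW g0) andbT gerBl ltW.
  have ge0 x : 0 <= ge x by rewrite le_max lexx orbT.
  apply: belowP; first exact: CbD.
  - move=> x; have [->|[h0 [geg _]]] := hge x; first exact: below_le1 bh.
    have -> : (h + ge) x = ge x by rewrite -[LHS]/(h x + ge x) h0 add0r.
    rewrite ge0/=; apply: le_trans geg _.
    by have /andP[] := below_le1 x bg.
  - move=> x; have [->|[_ [_ /(below_gt0 bg)[]]]] := hge x => //.
    by move=> /(below_gt0 bh)[].
rewrite -{1}(fineK (outer_mass_fin (V `&` ~` U))) lee_fin => h1.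
by lra.
Qed.

Hypothesis L_cont : forall u : nat -> T -> R^o, (forall n, Cb (u n)) ->
  (forall n x, 0 <= u n x) -> (forall n x, u n.+1 x <= u n x) ->
  (forall x e, 0 < e -> exists n, u n x <= e) ->
  forall e, 0 < e -> exists n, L (u n) <= e.

Hypothesis cozero : forall U, open U ->
  exists d : T -> R^o, [/\ Cb d, forall x, 0 <= d x & U = [set x | 0 < d x]].

(** If [U n] is the cozero set of [d n], the functions
    [s N = \sum_(n < N) min (1, N d n)] increase on the union of the [U n] to a
    limit at least 1.  So for [g] below the union, [g - min (g, s N)] decreases
    to 0 and Daniell continuity bounds [L g] by [L (s N)] up to [e]. *)
Lemma inner_mass_bigcup (U : nat -> set T) : (forall n, open (U n)) ->
  (inner_mass (\bigcup_n U n) <= \sum_(n <oo) inner_mass (U n))%E.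
Proof.
move=> oU; apply: ge_ereal_sup => _ [g bg <-].
apply/lee_addgt0Pr => e e0.
have Cg : Cb g by case: bg.
have /choice[d dP] := fun n => cozero (oU n).
have Cd n : Cb (d n) by have [] := dP n.
have d0 n x : 0 <= d n x by have [_ + _] := dP n; apply.
have Ud n : U n = [set x | 0 < d n x] by have [] := dP n.
pose h N n : T -> R^o := cst 1 \min (N%:R *: d n).
have hE N n x : h N n x = Num.min 1 (N%:R * d n x) by [].
have Ch N n : Cb (h N n) by apply: Cb_min; [exact: Cb_cst|exact: CbZ].
have h0 N n x : 0 <= h N n x by rewrite hE le_min ler01 mulr_ge0.
have hU N n : below (U n) (h N n).
  apply: belowP => // [x|x]; first by rewrite h0 hE ge_min lexx.
  rewrite hE lt_min Ud/= ltr01/= => Nd; rewrite lt_neqAle d0 andbT.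
  by apply/eqP => d0'; move: Nd; rewrite -d0' mulr0 ltxx.
pose s N : T -> R^o := \sum_(n < N) h N n.
have Cs N : Cb (s N) by exact: Cb_sum.
have sE N x : s N x = \sum_(n < N) h N n x by rewrite /s fct_sumE.
have s0 N x : 0 <= s N x by rewrite sE sumr_ge0.
have sS N x : s N x <= s N.+1 x.
  rewrite !sE big_ord_recr/= ler_wpDr//; apply: ler_sum => i _.
  rewrite !hE le_min ge_min lexx/= ge_min; apply/orP; right.
  by rewrite ler_wpM2r// ler_nat.
pose u N : T -> R^o := g - (g \min s N).
have uE N x : u N x = g x - Num.min (g x) (s N x) by [].
have Cm N : Cb (g \min s N : T -> R^o) by exact: Cb_min.
have [||||N LN] := L_cont (u := u) _ _ _ _ e0.
- by move=> n; apply: CbB.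
- by move=> n x; rewrite uE subr_ge0 ge_min lexx.
- move=> n x; rewrite !uE lerD2l lerN2 le_min ge_min lexx/= ge_min.
  by rewrite sS orbT.
- move=> x e1 e10; have /andP[gx0 gx1] := below_le1 x bg.
  move: gx0; rewrite le_eqVlt => /orP[/eqP gx0|gx0].
    by exists 0%N; rewrite uE -gx0 min_l ?subr0 ?(ltW e10).
  have [n _ Unx] := below_gt0 bg gx0.
  have dx : 0 < d n x by move: Unx; rewrite Ud.
  pose k := Num.truncn (d n x)^-1.
  have kd : 1 <= k.+1%:R * d n x.
    by rewrite -ler_pdivrMr// mul1r ltW// truncnS_gt.
  (* [U n] is among the first [N] sets and [N * d n x >= 1] *)
pose N := (maxn k n).+1.
  exists N; rewrite uE min_l ?subrr ?(ltW e10)//.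
  apply: le_trans gx1 _; rewrite sE.
  have nN : (n < N)%N by rewrite ltnS leq_maxr.
  rewrite (bigD1 (Ordinal nN))//= ler_wpDr ?sumr_ge0//.
  rewrite hE le_min lexx/= (le_trans kd)// ler_wpM2r// ler_nat.
  by rewrite ltnS leq_maxl.
have gE : g = u N + (g \min s N) by rewrite /u subrK.
have -> : L g = L (u N) + L (g \min s N).
  by rewrite {1}gE LD//; exact: CbB.
rewrite EFinD addeC; apply: leeD; last by rewrite lee_fin.
apply: (@le_trans _ _ (L (s N))%:E).
  by rewrite lee_fin; apply: L_le => // x; rewrite ge_min lexx orbT.
rewrite L_sum// -sumEFin.
apply: (@le_trans _ _ (\sum_(n < N) inner_mass (U n))%E).
  by apply: lee_sum => i _; exact: inner_mass_ge.
rewrite -(big_mkord xpredT (fun n => inner_mass (U n))).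
by apply: nneseries_lim_ge => n _; rewrite inner_mass_ge0.
Qed.

Lemma outer_mass_sigma_subadditive : sigma_subadditive outer_mass.
Proof.
move=> F; apply/lee_addgt0Pr => e e0.
have ex n : exists U, [/\ open U, F n `<=` U &
    (inner_mass U <= outer_mass (F n) + (e / (2 ^ n.+1)%:R)%:E)%E].
  have en : 0 < e / (2 ^ n.+1)%:R by rewrite divr_gt0// ltr0n expn_gt0.
  have [_ [U [oU FU] <-] tU] := lb_ereal_inf_adherent en (outer_mass_fin (F n)).
  by exists U; split => //; exact: ltW.
have /choice[U UP] := ex.
apply: (@le_trans _ _ (inner_mass (\bigcup_n U n))).
  apply: outer_mass_le_inner; first by apply: bigcup_open => n _; have [] := UP n.
  by apply: subset_bigcup => n _; have [] := UP n.
apply: le_trans (inner_mass_bigcup _) _; first by move=> n; have [] := UP n.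
apply: le_trans (epsilon_trick _ _ (ltW e0)); last by move=> n; exact: outer_mass_ge0.
apply: lee_nneseries => n _ ; first by rewrite inner_mass_ge0.
by have [] := UP n.
Qed.

(** Open sets satisfy Caratheodory's criterion by [inner_mass_split], so the
    outer measure is sigma-additive on the sigma-algebra they generate. *)
Lemma riesz_measure : exists mu : ca_pos R T,
  forall U, open U -> mu U = inner_mass U.
Proof.
pose OM : {outer_measure set T -> \bar R} := HB.pack outer_mass
  (isOuterMeasure.Build R T outer_mass outer_mass_set0 outer_mass_ge0 outer_mass_le
     outer_mass_sigma_subadditive).
have openM U : open U -> caratheodory_measurable OM U.
  move=> oU; apply: le_caratheodory_measurable => X.
  apply: le_ereal_inf_tmp => _ [V [oV XV] <-].
  apply: le_trans (inner_mass_split oU oV); apply: leeD.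
    by apply: outer_mass_le_inner; [exact: openI|exact: setSI].
  by apply: outer_mass_le; exact: setSI.
have borelM (A : set (borel T)) : measurable A ->
    measurable (A : set (caratheodory_type OM)).
  move=> mA; apply: (mA [set B | caratheodory_measurable OM B]).
  split; last exact: openM.
  split.
  - exact: caratheodory_measurable_set0.
  - by move=> A' mA'; rewrite setTD; exact: caratheodory_measurable_setC.
  - exact: caratheodory_measurable_bigcup.
pose out' : set (borel T) -> \bar R := outer_mass.
have sadd : semi_sigma_additive out'.
  move=> F mF tF mbF.
  by apply: (@caratheodory_measure_sigma_additive _ _ OM) => // [i|]; exact: borelM.
have out0 : out' set0 = 0%E by exact: outer_mass_set0.
have out_ge0 A : (0 <= out' A)%E by exact: outer_mass_ge0.
have out_fin : fin_num_fun out' by move=> A _; exact: outer_mass_fin.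
pose bm := isMeasure.Build _ (borel T) R out' out0 out_ge0 sadd.
pose mu0 : {measure set (borel T) -> \bar R} := HB.pack out' bm.
pose mu : ca_pos R T :=
  HB.pack out' bm (Measure_isFinite.Build _ (borel T) R mu0 out_fin).
by exists mu => U oU; exact: outer_mass_open.
Qed.

End positive_functional.

(** * Comparison of two positive linear forms by layers *)

Section layer_cake.
Set Implicit Arguments.
Unset Strict Implicit.
Context {R : realType} {T : ptopologicalType} (L J : (T -> R^o) -> R).
Implicit Types f g h : T -> R^o.

Hypothesis L_lin : forall a f g, Cb f -> Cb g -> L (a *: f + g) = a * L f + L g.
Hypothesis J_lin : forall a f g, Cb f -> Cb g -> J (a *: f + g) = a * J f + J g.
Hypothesis J_ge0 : forall f, Cb f -> (forall x, 0 <= f x) -> 0 <= J f.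
Hypothesis LJ1 : L (cst 1) = J (cst 1).
Hypothesis LJ_layer : forall g h, Cb g -> Cb h -> (forall x, 0 <= g x <= 1) ->
  (forall x, 0 <= h x) -> (forall x, 0 < g x -> 1 <= h x) -> L g <= J h.

(** The part of [y] between the heights [k] and [k + 1], as a number in
    [[0, 1]]. *)
Definition layer (y : R) (k : nat) : R := Num.min (Num.max (y - k%:R) 0) 1.

Lemma sum_layer y n : 0 <= y -> \sum_(k < n) layer y k = Num.min y n%:R.
Proof.
move=> y0; elim: n => [|n ih]; first by rewrite big_ord0 min_r.
rewrite big_ord_recr/= ih /layer -natr1.
have n0 : (0 : R) <= n%:R by [].
rewrite !minEle maxEle; do !case: ifPn; rewrite -?ltNge; lra.
Qed.

(** Cut [n f] into its [n] layers.  Where the layer [k + 1] is positive the layer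
    [k] equals 1, so [LJ_layer] bounds [L] of the former by [J] of the latter.
    Summing, the shift by one layer costs only [L 1 / n] overall. *)
Lemma le_of_layer01 f : Cb f -> (forall x, 0 <= f x <= 1) -> L f <= J f.
Proof.
move=> Cf f01; apply/ler_addgt0Pr => e e0.
pose n := (Num.truncn (J (cst 1) / e)).+1.
have n0 : (0 : R) < n%:R by [].
have Jn : J (cst 1) <= n%:R * e by rewrite -ler_pdivrMr// ltW// truncnS_gt.
pose F k : T -> R^o := fun x => layer (n%:R * f x) k.
have CF k : Cb (F k).
  have -> : F k = ((n%:R *: f - cst k%:R) \max cst 0) \min cst 1 by [].
  apply: Cb_min (Cb_cst _); apply: Cb_max (Cb_cst _).
  by apply: CbB (Cb_cst _); exact: CbZ.
have F01 k x : 0 <= F k x <= 1.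
  by rewrite /F /layer le_min le_max lexx ler01 orbT/= ge_min lexx orbT.
have nf : n%:R *: f = \sum_(0 <= k < n) F k.
  rewrite big_mkord; apply/funext => x; have /andP[f0 f1] := f01 x.
  rewrite fct_sumE sum_layer ?mulr_ge0// min_l// -[leRHS]mulr1.
  by rewrite ler_wpM2l.
rewrite -(ler_pM2l n0) mulrDr -(linZ L_lin n%:R Cf) -(linZ J_lin n%:R Cf).
rewrite nf (lin_sum L_lin _ (fun k => CF k)) (lin_sum J_lin _ (fun k => CF k)).
rewrite big_nat_recl// addrC [in leRHS]big_nat_recr//= -addrA.
apply: lerD.
  apply: ler_sum_nat => k _; apply: LJ_layer => //.
    by move=> x; have /andP[] := F01 k x.
  move=> x; rewrite /F /layer lt_min ltr01 andbT lt_max ltxx orbF -natr1.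
  by move=> h; rewrite le_min lexx andbT le_max; apply/orP; left; lra.
apply: (@le_trans _ _ (J (cst 1))).
  rewrite LJ_layer//; first exact: Cb_cst.
apply: ler_wpDl => //; apply: J_ge0 => // x.
by have /andP[] := F01 n.-1 x.
Qed.

Lemma le_of_layer f : Cb f -> L f <= J f.
Proof.
move=> Cf; have /CbP[_ [M fM]] := Cf.
pose c := `|M| + 1.
have c0 : 0 < c by rewrite ltr_wpDl.
have fc x : - c <= f x <= c.
  rewrite -ler_norml (le_trans (fM x))// (le_trans (ler_norm _))// lerDl.
  exact: ler01.
have C1 : Cb (cst 1 : T -> R^o) by exact: Cb_cst.
(* the affine change of scale that maps [[-c, c]] onto [[0, 1]] *)
pose g : T -> R^o := (2 * c)^-1 *: (c *: cst 1 + f).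
have Cg : Cb g by apply: CbZ; exact: Cb_lin.
have : L g <= J g.
  apply: le_of_layer01 => // x; rewrite -[g x]/((2 * c)^-1 * (c * 1 + f x)).
  have /andP[f1 f2] := fc x.
  rewrite mulr_ge0 ?invr_ge0 ?mulr_ge0 ?(ltW c0)//=; last by lra.
  by rewrite mulrC ler_pdivrMr ?mulr_gt0//; lra.
rewrite (linZ L_lin) ?(linZ J_lin); try exact: Cb_lin.
rewrite ler_pM2l ?invr_gt0 ?mulr_gt0// L_lin// J_lin// LJ1.
by rewrite lerD2l.
Qed.

Lemma eq_of_layer f : Cb f -> L f = J f.
Proof.
move=> Cf; apply/eqP; rewrite eq_le le_of_layer//=.
have := le_of_layer (CbN Cf).
by rewrite -(scaleN1r f) (linZ L_lin)// (linZ J_lin)// !mulN1r lerN2.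
Qed.

End layer_cake.

(** * Integration of bounded Borel functions *)

Section integration.
Set Implicit Arguments.
Unset Strict Implicit.
Context {R : realType} {T : ptopologicalType} (mu : ca_pos R T).
Implicit Types f g : T -> R^o.

Lemma Bb_integrable f : Bb f -> mu.-integrable [set: borel T] (EFin \o f).
Proof.
move=> [mf bf]; apply: measurable_bounded_integrable => //.
by rewrite -ge0_fin_numE//; exact: fin_num_measure.
Qed.

Lemma pairing_fin_num f : Bb f -> pairing f mu \is a fin_num.
Proof. by move=> Bf; apply: integrable_fin_num => //; exact: Bb_integrable. Qed.

Lemma pairing_lin (a : R) f g : Bb f -> Bb g ->
  (pairing (a *: f + g)%R mu = a%:E * pairing f mu + pairing g mu)%E.
Proof.
move=> Bf Bg; rewrite /pairing -integralZl//; last exact: Bb_integrable.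
rewrite -integralD//; last 2 first.
- by apply: integrableZl => //; exact: Bb_integrable.
- exact: Bb_integrable.
Qed.

Lemma pairing_ge0 f : (forall x, 0 <= f x) -> (0%R <= pairing f mu)%E.
Proof. by move=> f0; apply: integral_ge0 => x _; rewrite lee_fin. Qed.

Lemma pairing_cst1 : pairing (cst 1) mu = mu setT.
Proof.
by rewrite [LHS](integral_cst mu (@measurableT _ (borel T)) 1%E) mul1e.
Qed.

Lemma le_measure_pairing (U : set T) f : open U -> Bb f ->
  (forall x, 0 <= f x) -> (forall x, U x -> 1 <= f x) -> (mu U <= pairing f mu)%E.
Proof.
move=> oU [mf _] f0 Uf; have mU := open_borel oU.
rewrite -[U]setIT -(@integral_indic _ (borel T))//.
apply: ge0_le_integral => //.
- by apply/measurable_EFinP; exact: measurable_indic.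
- by apply/measurable_EFinP.
- move=> x _; rewrite lee_fin indicE.
  by case: (boolP (x \in U)) => // /set_mem/Uf.
Qed.

End integration.

(** * The Riesz-Daniell representation theorem *)

Section riesz_daniell.
Set Implicit Arguments.
Unset Strict Implicit.
Context {R : realType} {T : ptopologicalType} (L : (T -> R^o) -> R).
Implicit Types f g : T -> R^o.

(** The form [L] and integration against [mu] agree by the comparison by
    layers: [L g <= inner_mass [set x | 0 < g x] = mu [set x | 0 < g x] <= <h, mu>]
    as soon as [0 <= g <= 1] and [h >= 1] where [g > 0]. *)
Theorem riesz_daniell :
  (forall a f g, Cb f -> Cb g -> L (a *: f + g) = a * L f + L g) ->
  (forall f, Cb f -> (forall x, 0 <= f x) -> 0 <= L f) ->
  (forall u : nat -> T -> R^o, (forall n, Cb (u n)) ->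
    (forall n x, 0 <= u n x) -> (forall n x, u n.+1 x <= u n x) ->
    (forall x e, 0 < e -> exists n, u n x <= e) ->
    forall e, 0 < e -> exists n, L (u n) <= e) ->
  (forall U : set T, open U -> exists d : T -> R^o,
    [/\ Cb d, forall x, 0 <= d x & U = [set x | 0 < d x]]) ->
  exists mu : ca_pos R T, forall f, Cb f -> pairing f mu = (L f)%:E.
Proof.
move=> L_lin L_ge0 L_cont cozero.
have [mu muE] := riesz_measure L_lin L_ge0 L_cont cozero.
exists mu => f Cf.
have finC g : Cb g -> pairing g mu \is a fin_num.
  by move=> Cg; apply: pairing_fin_num; exact: Cb_Bb.
pose J g := fine (pairing g mu).
have JE g : Cb g -> pairing g mu = (J g)%:E by move=> Cg; rewrite fineK ?finC.
rewrite JE//; congr EFin; apply/esym.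
apply: (eq_of_layer (J := J)) => //.
- move=> a g h Cg Ch; apply: EFin_inj; rewrite EFinD EFinM -!JE//.
    by apply: pairing_lin; exact: Cb_Bb.
  exact: Cb_lin.
- by move=> g Cg g0; rewrite fine_ge0 ?pairing_ge0.
- apply: EFin_inj; rewrite -JE; last exact: Cb_cst.
  rewrite pairing_cst1 muE; last exact: openT.
  exact/esym/inner_mass_setT.
- move=> g h Cg Ch g01 h0 gh; rewrite -lee_fin -JE//.
  pose U := [set x | 0 < g x]; have oU : open U by exact: open_gt_Cb.
  apply: (@le_trans _ _ (mu U)).
    by rewrite muE//; apply: inner_mass_ge; exact: belowP.
  by apply: le_measure_pairing => //; exact: Cb_Bb.
Qed.

End riesz_daniell.

(** * Open sets of pseudometric spaces *)

Section cozero.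
Set Implicit Arguments.
Unset Strict Implicit.
Context {R : realType} {T : pseudoMetricType R}.

(** The function [d] is the distance to the complement of [U] truncated at 1,
    which keeps it finite when the complement is empty or at infinite extended
    distance. *)
Lemma open_cozero (U : set T) : open U -> exists d : T -> R^o,
  [/\ continuous d, forall x, 0 <= d x <= 1 & U = [set x | 0 < d x]].
Proof.
move=> oU; pose m x := mine (edist_inf (~` U) x) 1%E.
pose d x : R^o := fine (m x).
have m0 x : (0 <= m x)%E by rewrite le_min edist_inf_ge0 lee01.
have m1 x : (m x <= 1)%E by rewrite ge_min lexx orbT.
have dE x : (d x)%:E = m x.
  by rewrite fineK// ge0_fin_numE// (le_lt_trans (m1 x))// ltry.
have d_lip x y (e : R) : 0 < e -> ball x e y -> d x <= e + d y.
  move=> e0 xy; rewrite -lee_fin EFinD !dE /m [in leRHS]minEle.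
  case: ifPn => _; last first.
    by rewrite ge_min -EFinD lee_fin lerDr (ltW e0) orbT.
  rewrite ge_min (le_trans (edist_inf_triangle (~` U) x y))//.
  by rewrite leeD2r// edist_fin.
exists d; split.
- move=> x; apply/cvgrPdist_le => e e0.
  near=> y; have xy : ball x e y by near: y; exact: nbhsx_ballx.
  have := d_lip _ _ _ e0 xy; have := d_lip _ _ _ e0 (ball_sym xy).
  by rewrite ler_norml; lra.
- by move=> x; rewrite -!lee_fin dE m0 m1.
- apply/seteqP; split => x /=.
    move=> Ux; have /nbhs_ballP[e /= e0 xU] := open_nbhs_nbhs (conj oU Ux).
    rewrite -lte_fin dE lt_min lte01 andbT; apply: (@lt_le_trans _ _ e%:E) => //.
    apply: le_ereal_inf_tmp => _ [a Ua <-]; rewrite leNgt; apply/negP => xa.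
    by apply/Ua/xU; exact: edist_lt_ball xa.
  rewrite -lte_fin dE => dx; apply: contrapT => Ux.
  by move: dx; rewrite /m edist_inf0// min_l ?lee01// ltxx.
Unshelve. all: by end_near. Qed.

End cozero.

(** * Continuity of tight convex functionals along decreasing sequences *)

Section dini.
Set Implicit Arguments.
Unset Strict Implicit.
Context {R : realType} {T : topologicalType}.

Lemma dini_compact (K : set T) (u : nat -> T -> R^o) (e : R) :
  compact K -> (forall n, continuous (u n)) ->
  (forall n x, u n.+1 x <= u n x) ->
  (forall x, exists n, u n x < e) ->
  exists n, forall x, K x -> u n x < e.
Proof.
move=> /compact_near_coveringP cK cu uS ue.
have u_le x m n : (m <= n)%N -> u n x <= u m x.
  move=> /subnK <-; elim: (n - m)%N => [|k ih]; first by rewrite add0n.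
  by rewrite addSn (le_trans _ ih).
have [] := cK nat \oo (fun n x => u n x < e).
  move=> x _; have [n nx] := ue x.
  exists ([set y | u n y < e], [set m | (n <= m)%N]); first split.
  - by have := cvgr_lt _ (cu n x) _ nx; exact.
  - by exists n.
  - by move=> [y m] [/= yn nm]; apply: le_lt_trans yn; exact: u_le.
by move=> n _ /(_ n (leqnn n)) h; exists n => x Kx; exact: h.
Qed.

End dini.

Section tight_functional.
Set Implicit Arguments.
Unset Strict Implicit.
Context {R : realType} {T : ptopologicalType} (phi : (T -> R^o) -> R).
Implicit Types f g : T -> R^o.

Hypothesis phi_incr : increasing_on (@Bb R T) phi.
Hypothesis phi_convex : @convex_function R (T -> R^o) (@Bb R T) phi.
Hypothesis phi_tight : forall m e : R, 0 < m -> 0 < e -> exists K : set T,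
  [/\ compact K, closed K & phi (fun x => m * \1_(~` K) x) <= e].

Lemma convex_functionE (s t : R) f g : 0 <= s -> 0 <= t -> s + t = 1 ->
  Bb f -> Bb g -> phi (s *: f + t *: g) <= s * phi f + t * phi g.
Proof.
move=> s0 t0 st Bf Bg; have s1 : s <= 1 by rewrite -st lerDl.
have -> : t = 1 - s by rewrite -st addrAC subrr add0r.
exact: (phi_convex (Itv01 s0 s1) (mem_set Bf) (mem_set Bg)).
Qed.

Lemma Bb_indic_scale (m : R) (K : set T) :
  closed K -> Bb (fun x => m * \1_(~` K) x : R^o).
Proof.
move=> cK; split.
  apply: measurable_funM => //; apply: measurable_indic.
  by apply: measurableC; exact: closed_borel.
exists `|m|; split; first exact: num_real.
move=> M mM x _ /=; rewrite (le_trans _ (ltW mM))// normrM ler_piMr//.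
by rewrite indicE; case: (_ \in _); rewrite ?normr1 ?normr0.
Qed.

(** Let [M] bound [f] and [f + u 0], and let [K] be a compact set with
    [phi ((2 M / t) 1_{K^c}) <= 1] and [u n < t] on [K].  Then [f + u n] is at
    most the convex combination of [f], [f + 1] and [(2 M / t) 1_{K^c}] with
    weights [1 - (M + 2) t], [(M + 1) t] and [t]: on [K] because the combination
    of the first two is [(1 - t) f + (M + 1) t >= f + t], off [K] because the
    third contributes [2 M].  By convexity [phi (f + u n)] exceeds [phi f] by at
    most a constant times [t]. *)
Lemma tight_continuity f (u : nat -> T -> R^o) (e : R) : Cb f ->
  (forall n, Cb (u n)) -> (forall n x, 0 <= u n x) ->
  (forall n x, u n.+1 x <= u n x) ->
  (forall x e, 0 < e -> exists n, u n x <= e) -> 0 < e ->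
  exists n, phi (f + u n) <= phi f + e.
Proof.
move=> Cf Cu u0 uS uc e0.
have /CbP[_ [Mf fM]] := Cf; have /CbP[_ [Mu uM]] := Cu 0%N.
pose M := `|Mf| + `|Mu| + 1.
have M0 : 0 < M by rewrite ltr_wpDl// addr_ge0.
have u_le n x : u n x <= u 0%N x.
  by elim: n => [//|n ih]; exact: le_trans (uS n x) ih.
have fuM n x : - M <= f x <= M /\ f x + u n x <= M.
  have := ler_norm Mf; have := ler_norm Mu; have := uM x; have := fM x.
  have := u_le n x; rewrite !ler_norml /M => ? /andP[? ?] /andP[? ?] ? ?.
  have := normr_ge0 Mf; have := normr_ge0 Mu.
  by split; [apply/andP; split|]; lra.
have C1 : Cb (f + cst 1 : T -> R^o) by apply: CbD => //; exact: Cb_cst.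
pose C := `|1 - (M + 2) * phi f + (M + 1) * phi (f + cst 1)| + 1.
have C0 : 0 < C by rewrite ltr_wpDl.
pose t := Num.min (e / C) (2 * (M + 2))^-1.
have M20 : 0 < 2 * (M + 2) by rewrite mulr_gt0// addr_gt0.
have t0 : 0 < t by rewrite lt_min divr_gt0//= invr_gt0.
have tC : t * C <= e by rewrite -ler_pdivlMr// ge_min lexx.
have tM : t * (2 * (M + 2)) <= 1.
  by rewrite -ler_pdivlMr// mul1r ge_min lexx orbT.
have M1t0 : 0 < (M + 1) * t by rewrite mulr_gt0// addr_gt0.
have [K [cK clK phiK]] := phi_tight (divr_gt0 (addr_gt0 M0 M0) t0) ltr01.
pose b : T -> R^o := fun x => ((M + M) / t) * \1_(~` K) x.
have Bbb : Bb b by exact: Bb_indic_scale.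
have [n un] : exists n, forall x, K x -> u n x < t.
  apply: dini_compact => //; first by move=> n; have [] := Cu n.
  move=> x; have [n un] := uc x (t / 2) (divr_gt0 t0 (ltr0Sn _ 1)).
  by exists n; rewrite (le_lt_trans un)// ltr_pdivrMr// ltr_pMr// ltr1n.
exists n.
have t1 : 0 < 1 - t by lra.
have t1n : 1 - t != 0 by rewrite gt_eqF.
(* the three-point combination is taken in two steps: [f] and [f + 1] are first
   averaged with relative weights [1 - s] and [s] *)
pose s := ((M + 1) * t) / (1 - t).
have s0 : 0 <= s by rewrite divr_ge0 ?ltW.
have sE : s * (1 - t) = (M + 1) * t by rewrite divfK.
have s1 : 0 <= 1 - s.
  rewrite subr_ge0 /s ler_pdivrMr// mul1r; lra.
pose y : T -> R^o := (1 - s) *: f + s *: (f + cst 1).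
have Cy : Cb y by apply: Cb_lin => //; exact: CbZ.
pose z : T -> R^o := (1 - t) *: y + t *: b.
have Bz : Bb z.
  have [mb bb] := Bbb; have [my byy] := Cb_Bb Cy; split.
    by apply: measurable_funD; apply: measurable_funM.
  have [My [_ yM]] := byy; have [Mb [_ bM]] := bb.
  apply/ex_bound; first exact: (globally_properfilter (a := point)).
  exists ((1 - t) * (My + 1) + t * (Mb + 1)) => x _ /=.
  rewrite (le_trans (ler_normD _ _))// (normrM (1 - t)) (normrM t).
  rewrite (ger0_norm (ltW t1)) (ger0_norm (ltW t0)).
  rewrite lerD// ler_wpM2l ?(ltW t0) ?(ltW t1)//; [apply: yM|apply: bM] => //;
    by rewrite ltrDl.
have fuz x : (f + u n) x <= z x.
  have -> : z x = (1 - t) * ((1 - s) * f x + s * (f x + 1)) + t * b x by [].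
  have -> : (1 - t) * ((1 - s) * f x + s * (f x + 1)) + t * b x =
      (1 - t) * f x + s * (1 - t) + t * b x by ring.
  rewrite sE -[leLHS]/(f x + u n x) /b indicE.
  have [/andP[f1 f2] f3] := fuM n x.
  have tf : t * f x <= t * M by rewrite ler_pM2l.
  have tf' : 0 <= t * (M - f x) by rewrite mulr_ge0 ?(ltW t0)// subr_ge0.
  have [Kx|nKx] := pselect (K x).
    have -> : (x \in ~` K) = false by apply/negbTE/negP => /set_mem.
    have := un _ Kx; rewrite !mulr0 addr0; lra.
  rewrite mem_set// mulr1 mulrCA divff ?gt_eqF// mulr1.
  have := mulr_ge0 (ltW t1) (ltW M0); have : 0 <= (1 - t) * (f x + M).
    by rewrite mulr_ge0 ?(ltW t1)//; lra.
  lra.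
apply: (@le_trans _ _ (phi z)).
  by apply: phi_incr => //; apply: Cb_Bb; exact: CbD.
have h1 : phi z <= (1 - t) * phi y + t * phi b.
  apply: convex_functionE => //; [exact: ltW|exact: ltW|by rewrite subrK|].
  exact: Cb_Bb.
have h2 : phi y <= (1 - s) * phi f + s * phi (f + cst 1).
  by apply: convex_functionE => //; [rewrite subrK|exact: Cb_Bb|exact: Cb_Bb].
apply: le_trans h1 _.
have h3 : (1 - t) * phi y <= (1 - t) * ((1 - s) * phi f + s * phi (f + cst 1)).
  by rewrite ler_pM2l.
have h4 : t * phi b <= t * 1 by rewrite ler_pM2l.
have h5 : (1 - t) * ((1 - s) * phi f + s * phi (f + cst 1)) =
  (1 - t) * phi f + (s * (1 - t)) * (phi (f + cst 1) - phi f) by ring.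
rewrite sE in h5.
have h6 : t * (1 - (M + 2) * phi f + (M + 1) * phi (f + cst 1)) <= t * C.
  rewrite ler_pM2l// /C.
  have := ler_norm (1 - (M + 2) * phi f + (M + 1) * phi (f + cst 1)).
  lra.
lra.
Qed.

End tight_functional.

(** * Tightness on a countable product *)

Section product_tightness.
Set Implicit Arguments.
Unset Strict Implicit.
Context {R : realType} {I : countType} {X : I -> pmetricType R}.

Lemma esum_geometric_le (a : I -> \bar R) (e : R) : 0 <= e ->
  (forall i, (a i <= (e / (2 ^ (pickle i).+1)%:R)%:E)%E) ->
  (\esum_(i in [set: I]) a i <= e%:E)%E.
Proof.
move=> e0 ae; pose c n : \bar R := (e / (2 ^ n.+1)%:R)%:E.
have c0 n : (0 <= c n)%E by rewrite lee_fin divr_ge0.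
apply: (@le_trans _ _ (\esum_(i in [set: I]) c (pickle i))%E).
  by apply: le_esum => i _; exact: ae.
have pickle_inj : set_inj [set: I] (@pickle I).
  by move=> i j _ _; exact: (pcan_inj pickleK).
rewrite -(esum_image [set: I] pickle c pickle_inj).
rewrite esum_mkcond; apply: (@le_trans _ _ (\esum_(n in [set: nat]) c n)%E).
  by apply: le_esum => n _; case: ifP.
rewrite -nneseries_esumT//; exact: epsilon_trick0.
Qed.

Lemma compact_metric_closed (Y : pmetricType R) (K : set Y) :
  compact K -> closed K.
Proof. by apply: compact_closed; exact: metric_hausdorff. Qed.

Lemma compact_box (K : forall i, set (X i)) : (forall i, compact (K i)) ->
  compact ([set x | forall i, K i (x i)] : set (prod_topology X)).
Proof. exact: tychonoff. Qed.

Lemma closed_box (K : forall i, set (X i)) : (forall i, closed (K i)) ->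
  closed ([set x | forall i, K i (x i)] : set (prod_topology X)).
Proof.
move=> cK.
have -> : [set x : prod_topology X | forall i, K i (x i)] =
    \bigcap_i (@proj I X i @^-1` K i).
  by apply/seteqP; split => x /= xK i; [move=> _; exact: xK|exact: xK].
apply: closed_bigI => i _; apply: preimage_closed => //.
by move=> x _; apply: (@proj_continuous I X).
Qed.

(** The complement of the box [\prod_i K_i] is the union of the cylinders over
    the complements of the [K_i], so [m 1_{K^c}] is at most the sum of the
    functions [m 1_{K_i^c}] of the single coordinates.  The [K_i] are chosen with
    costs [e / 2 ^ (pickle i).+1], of total at most [e]. *)
Lemma product_tight (phi_ : forall i, (X i -> R^o) -> R)
    (phi : (prod_topology X -> R^o) -> R) :
  (forall i (m e : R), 0 < m -> 0 < e ->
     exists2 K : set (X i), compact K &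
       phi_ i (fun x => m * \1_(~` K) x) <= e) ->
  (forall (f : prod_topology X -> R^o) (g : forall i, X i -> R^o),
     Bb f -> (forall i, Bb_nneg (g i)) ->
     (forall x, ((f x)%:E <= oplus g x)%E) ->
     ((phi f)%:E <= \esum_(i in [set: I]) (phi_ i (g i))%:E)%E) ->
  forall m e : R, 0 < m -> 0 < e -> exists K : set (prod_topology X),
    [/\ compact K, closed K & phi (fun x => m * \1_(~` K) x) <= e].
Proof.
move=> phi_tight phi_le m e m0 e0.
have en (n : nat) : 0 < e / (2 ^ n.+1)%:R by rewrite divr_gt0// ltr0n expn_gt0.
pose K i := projT1 (cid2 (phi_tight i m _ m0 (en (pickle i)))).
have cK i : compact (K i) by rewrite /K; case: cid2.
have phiK i : phi_ i (fun x => m * \1_(~` K i) x) <= e / (2 ^ (pickle i).+1)%:R.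
  by rewrite /K; case: cid2.
have clK i : closed (K i) by exact: compact_metric_closed.
pose B : set (prod_topology X) := [set x | forall i, K i (x i)].
have clB : closed B by exact: closed_box.
exists B; split => //; first exact: compact_box.
rewrite -lee_fin.
apply: le_trans (phi_le _ (fun i x => m * \1_(~` K i) x) _ _ _) _.
- exact: Bb_indic_scale.
- move=> i; split; first by have := Bb_indic_scale m (clK i); exact.
  by move=> x; rewrite mulr_ge0// ltW.
- move=> x.
  have t0 i : (0 <= (m * \1_(~` K i) (x i))%:E)%E by rewrite lee_fin mulr_ge0// ltW.
  have [Bx|nBx] := pselect (B x).
    have -> : \1_(~` B) x = 0 :> R by rewrite indicE memNset// => /(_ Bx).
    by rewrite mulr0; exact: esum_ge0.
  have /existsNP[i nKi] := nBx.
  apply: (@le_trans _ _ (\esum_(j in [set i]) (m * \1_(~` K j) (x j))%:E)%E).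
    by rewrite esum_set1// !indicE !mem_set.
  rewrite [leLHS]esum_mkcond; apply: le_esum => j _; case: ifP => // _.
- by apply: esum_geometric_le; [exact: ltW|move=> i; rewrite lee_fin].
Qed.

End product_tightness.

(** * Duality *)

Theorem theorem2p1 (R : realType) (I : countType) (X : I -> pmetricType R)
    (phi_ : forall i, (X i -> R^o) -> R)
    (phi : (prod_topology X -> R^o) -> R)
    (phi_ge0 : forall i g, Bb_nneg g -> 0 <= phi_ i g)
    (phi_tight : forall i (m e : R), 0 < m -> 0 < e ->
       exists2 K : set (X i), compact K &
         phi_ i (fun x => m * \1_(~` K) x) <= e)
    (phi_incr : increasing_on (@Bb R (prod_topology X)) phi)
    (phi_convex : @convex_function R (prod_topology X -> R^o)
       (@Bb R (prod_topology X)) phi)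
    (phi_le : forall (f : prod_topology X -> R^o) (g : forall i, X i -> R^o),
       Bb f -> (forall i, Bb_nneg (g i)) ->
       (forall x, ((f x)%:E <= oplus g x)%E) ->
       ((phi f)%:E <= \esum_(i in [set: I]) (phi_ i (g i))%:E)%E) :
  forall f : prod_topology X -> R^o, Cb f ->
    is_max [set (pairing f mu - conjugate_Cb phi mu)%E
             | mu in [set: ca_pos R (prod_topology X)]]
           (phi f)%:E.
Proof.
move=> f Cf.
have tight := product_tight phi_tight phi_le.
pose CbX := @Cb R (prod_topology X).
have CbBb g : CbX g -> @Bb R (prod_topology X) g by exact: Cb_Bb.
(* [l] is a subgradient of the restriction of [phi] to [Cb] at [f] *)
have [l [l_lin l_le]] : exists l : (prod_topology X -> R^o) -> R,
    (forall a g h, CbX g -> CbX h -> l (a *: g + h) = a * l g + l h) /\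
    (forall g, CbX g -> l g <= phi (f + g) - phi f).
  apply: hahn_banach_convex.
  - exact: Cb_cst.
  - by move=> a g h; exact: Cb_lin.
  - move=> s t g h s0 t0 Cg Ch st.
    have := convex_functionE phi_convex (ltW s0) (ltW t0) st
      (CbBb _ (CbD Cf Cg)) (CbBb _ (CbD Cf Ch)).
    rewrite !scalerDr addrACA -scalerDl st scale1r => /le_trans H.
    rewrite lerBlDr; apply: H.
    rewrite -[X in _ <= _ + X]mul1r -st.
    by rewrite le_eqVlt; apply/orP; left; apply/eqP; ring.
  - by rewrite addr0 subrr.
have l_ge0 g : CbX g -> (forall x, 0 <= g x) -> 0 <= l g.
  move=> Cg g0; have := l_le _ (CbN Cg).
  rewrite -(scaleN1r g) (linZ l_lin)// mulN1r scaleN1r => h.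
  rewrite -oppr_le0 (le_trans h)// subr_le0.
  apply: phi_incr; [exact/CbBb/CbB|exact: CbBb|].
  by move=> x; rewrite gerBl.
have l_cont (u : nat -> prod_topology X -> R^o) : (forall n, CbX (u n)) ->
    (forall n x, 0 <= u n x) -> (forall n x, u n.+1 x <= u n x) ->
    (forall x e, 0 < e -> exists n, u n x <= e) ->
    forall e, 0 < e -> exists n, l (u n) <= e.
  move=> Cu u0 uS uc e e0.
  have [n phin] := tight_continuity phi_incr phi_convex tight
    Cf Cu u0 uS uc e0.
  by exists n; rewrite (le_trans (l_le _ (Cu n)))// lerBlDr [e + _]addrC.
have cozero (U : set (prod_topology X)) : open U ->
    exists d : prod_topology X -> R^o,
      [/\ CbX d, forall x, 0 <= d x & U = [set x | 0 < d x]].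
  move=> oU; have [d [cd d01 Ud]] := @open_cozero R (prod_topology X) U oU.
  exists d; split => //; last by move=> x; have /andP[] := d01 x.
  apply/CbP; split => //; exists 1 => x.
  by have /andP[d0 d1] := d01 x; rewrite ger0_norm.
have [mu muE] := riesz_daniell l_lin l_ge0 l_cont cozero.
split.
  exists mu => //.
  have -> : conjugate_Cb phi mu = (l f - phi f)%:E.
    apply/eqP; rewrite eq_le; apply/andP; split.
      apply: ge_ereal_sup => _ [g Cg <-]; rewrite muE// -EFinB lee_fin.
      have Cgf : CbX (g - f) by exact: CbB.
      have := l_le _ Cgf; rewrite (linB l_lin)// [f + _]addrC subrK; lra.
    by apply: ereal_sup_ubound; exists f => //; rewrite muE// EFinB.
  by rewrite muE// -EFinB opprB addrC subrK.
move=> _ [nu _ <-].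
have nuf : pairing f nu \is a fin_num by apply: pairing_fin_num; exact: CbBb.
have : ((pairing f nu - (phi f)%:E) <= conjugate_Cb phi nu)%E.
  by apply: ereal_sup_ubound; exists f.
rewrite -(fineK nuf); case: (conjugate_Cb phi nu) => [r||] //=.
- by rewrite -!EFinB !lee_fin; lra.
- by rewrite addeNy leNye.
Qed.
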